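(* Let $X$ be a paracompact $C$-space, $(Y,\rho)$ a metric space, and $\varphi:X\rightrightarrows Y$ a $\rho$-continuous mapping such that each $\varphi(x)$, $x\in X$, is uniformly $UV^\infty$ (i.e. CE). Then for every continuous function $\varepsilon:X\to(0,+\infty)$, $\varphi$ has a continuous $\varepsilon$-selection.
   Context: A space $X$ is a $C$-space if for every sequence $\{\mathscr{U}_n:n<\omega\}$ of open covers of $X$ there is a sequence $\{\mathscr{V}_n:n<\omega\}$ of families of pairwise disjoint open subsets of $X$ such that each $\mathscr{V}_n$ refines $\mathscr{U}_n$ and $\bigcup_n\mathscr{V}_n$ covers $X$. A set-valued mapping $\varphi:X\rightrightarrows Y$ assigns a nonempty subset $\varphi(x)\subset Y$ to each $x$. $\mathbf{O}_\varepsilon(S)=\bigcup_{q\in S}\{y:\rho(y,q)<\varepsilon\}$. $\varphi$ is $\rho$-continuous if for every $\varepsilon>0$ each $x\in X$ has a neighbourhood $V$ with $\varphi(x)\subset\mathbf{O}_\varepsilon(\varphi(p))$ and $\varphi(p)\subset\mathbf{O}_\varepsilon(\varphi(x))$ for all $p\in V$. A subset $S\subset Y$ is uniformly $UV^\infty$ (CE) if for every $\varepsilon>0$ there exists $\delta\in(0,\varepsilon]$ such that $\mathbf{O}_\delta(S)$ is contractible in $\mathbf{O}_\varepsilon(S)$ (the inclusion $\mathbf{O}_\delta(S)\to\mathbf{O}_\varepsilon(S)$ is homotopic to a constant map). A map $f:X\to Y$ is an $\varepsilon$-selection for $\varphi$ if $f(x)\in\mathbf{O}_{\varepsilon(x)}(\varphi(x))$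 for every $x\in X$. *)

(* Defs.v *)
From Stdlib Require Import Reals List.
Open Scope R_scope.

Definition is_topology {X : Type} (op : (X -> Prop) -> Prop) : Prop :=
  op (fun _ => True) /\ op (fun _ => False) /\
  (forall U V, op U -> op V -> op (fun x => U x /\ V x)) /\
  (forall F : (X -> Prop) -> Prop,
     (forall U, F U -> op U) -> op (fun x => exists U, F U /\ U x)).

Definition hausdorff {X : Type} (op : (X -> Prop) -> Prop) : Prop :=
  forall x y : X, x <> y ->
    exists U V, op U /\ op V /\ U x /\ V y /\ (forall z, ~ (U z /\ V z)).

Definition open_cover {X I : Type} (op : (X -> Prop) -> Prop) (U : I -> X -> Prop) : Prop :=
  (forall i, op (U i)) /\ (forall x, exists i, U i x).

Definition refines {X I J : Type} (V : J -> X -> Prop) (U : I -> X -> Prop) : Prop :=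
  forall j, exists i, forall x, V j x -> U i x.

Definition locally_finite {X J : Type} (op : (X -> Prop) -> Prop) (V : J -> X -> Prop) : Prop :=
  forall x, exists W, op W /\ W x /\
    exists L : list J, forall j, (exists z, W z /\ V j z) -> In j L.

Definition paracompact {X : Type} (op : (X -> Prop) -> Prop) : Prop :=
  hausdorff op /\
  forall (I : Type) (U : I -> X -> Prop), open_cover op U ->
    exists (J : Type) (V : J -> X -> Prop),
      open_cover op V /\ refines V U /\ locally_finite op V.

Definition pairwise_disjoint {X J : Type} (V : J -> X -> Prop) : Prop :=
  forall j j', j <> j' -> forall x, ~ (V j x /\ V j' x).

Definition C_space {X : Type} (op : (X -> Prop) -> Prop) : Prop :=
  forall (I : nat -> Type) (U : forall n, I n -> X -> Prop),
    (forall n, open_cover op (U n)) ->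
    exists (J : nat -> Type) (V : forall n, J n -> X -> Prop),
      (forall n j, op (V n j)) /\
      (forall n, pairwise_disjoint (V n)) /\
      (forall n, refines (V n) (U n)) /\
      (forall x, exists n j, V n j x).

Definition is_metric {Y : Type} (rho : Y -> Y -> R) : Prop :=
  (forall x y, 0 <= rho x y) /\
  (forall x y, rho x y = 0 <-> x = y) /\
  (forall x y, rho x y = rho y x) /\
  (forall x y z, rho x z <= rho x y + rho y z).

Definition metric_open {Y : Type} (rho : Y -> Y -> R) (U : Y -> Prop) : Prop :=
  forall y, U y -> exists r, 0 < r /\ forall z, rho y z < r -> U z.

Definition abs_dist (a b : R) : R := Rabs (a - b).

Definition continuous {X Y : Type} (opX : (X -> Prop) -> Prop)
  (opY : (Y -> Prop) -> Prop) (f : X -> Y) : Prop :=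
  forall V, opY V -> opX (fun x => V (f x)).

Definition O_nbhd {Y : Type} (rho : Y -> Y -> R) (e : R) (S : Y -> Prop) : Y -> Prop :=
  fun y => exists q, S q /\ rho y q < e.

Definition subset {Y : Type} (A B : Y -> Prop) : Prop := forall y, A y -> B y.

Definition rho_continuous {X Y : Type} (op : (X -> Prop) -> Prop) (rho : Y -> Y -> R)
  (phi : X -> Y -> Prop) : Prop :=
  forall e, 0 < e -> forall x, exists V, op V /\ V x /\
    forall p, V p -> subset (phi x) (O_nbhd rho e (phi p)) /\
                     subset (phi p) (O_nbhd rho e (phi x)).

(* H : A x [0,1] -> Y continuous, for A a subset of the metric space (Y,rho),
   with respect to the product (max) metric on Y x R restricted to A x [0,1] *)
Definition continuous_on_cyl {Y : Type} (rho : Y -> Y -> R) (A : Y -> Prop)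
  (H : Y -> R -> Y) : Prop :=
  forall y t, A y -> 0 <= t <= 1 ->
    forall e, 0 < e -> exists d, 0 < d /\
      forall y' t', A y' -> 0 <= t' <= 1 -> rho y y' < d -> Rabs (t - t') < d ->
        rho (H y t) (H y' t') < e.

Definition contractible_in {Y : Type} (rho : Y -> Y -> R) (A B : Y -> Prop) : Prop :=
  exists (H : Y -> R -> Y) (c : Y),
    continuous_on_cyl rho A H /\
    (forall y t, A y -> 0 <= t <= 1 -> B (H y t)) /\
    (forall y, A y -> H y 0 = y) /\
    (forall y, A y -> H y 1 = c).

Definition uniformly_UV_infty {Y : Type} (rho : Y -> Y -> R) (S : Y -> Prop) : Prop :=
  forall e, 0 < e -> exists d, 0 < d /\ d <= e /\
    contractible_in rho (O_nbhd rho d S) (O_nbhd rho e S).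

(* Main.v *)
(** Call a relation [S] between [X] and [Y] thick if, locally uniformly in [x], the fibre [S x] contains
    a neighbourhood of [phi x] of fixed radius.  By the CE property every thick [S] contains a thick [S']
    and admits a locally finite open cover such that over each member of the cover the fibres of [S']
    are contracted to a point by a single homotopy running inside the fibres of [S].  Iterating from
    [S_0 x = O_eps(x) (phi x)] gives covers [U_n], to which the C-property is applied: over the
    disjoint family [V_n] the n-th homotopies, run up to time [s_n x] for a Urysohn function [s_n],
    define a map [T_n] from [S_(n+1)] to [S_n], constant in [y] where [s_n = 1].  Every point has a
    neighbourhood on which some [s_n = 1], so there [T_0 o ... o T_n] no longer depends on its
    argument in [Y], and these local values glue to the selection. *)
Require Import Defs.
From Stdlib Require Import Reals Lra Lia List Classical ClassicalEpsilon.
From Stdlib Require Import FunctionalExtensionality PropExtensionality.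
Open Scope R_scope.

(** * Neighbourhood filters and sets with disjoint closures *)

Definition near {X : Type} (op : (X -> Prop) -> Prop) (x : X) (P : X -> Prop) : Prop :=
  exists O, op O /\ O x /\ forall z, O z -> P z.

(* [far A E] says that the closures of [A] and [E] are disjoint. *)
Definition far {X : Type} (op : (X -> Prop) -> Prop) (A E : X -> Prop) : Prop :=
  forall x, near op x (fun z => ~ A z) \/ near op x (fun z => ~ E z).

(** [M] need not be open: the first condition puts the closure of [A] in the interior of [M], the
    second keeps the closure of [M] away from that of [E]. *)
Definition separated {X : Type} (op : (X -> Prop) -> Prop) (A E : X -> Prop) : Prop :=
  exists M, far op A (fun z => ~ M z) /\ far op M E.

Section Topology.
Context {X : Type} (op : (X -> Prop) -> Prop) (Htop : is_topology op).

Lemma near_mono x (P Q : X -> Prop) :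
  near op x P -> (forall z, P z -> Q z) -> near op x Q.
Proof. intros (O & HO & Ox & HP) HPQ. exists O; auto. Qed.

Lemma near_self x P : near op x P -> P x.
Proof. intros (O & _ & Ox & HP). auto. Qed.

Lemma near_true x : near op x (fun _ => True).
Proof. exists (fun _ => True). firstorder. Qed.

Lemma near_and x (P Q : X -> Prop) :
  near op x P -> near op x Q -> near op x (fun z => P z /\ Q z).
Proof.
  intros (O & HO & Ox & HP) (O' & HO' & Ox' & HQ).
  exists (fun z => O z /\ O' z). split; [apply Htop; assumption|]. firstorder.
Qed.

Lemma near_open U x : op U -> U x -> near op x U.
Proof. exists U; auto. Qed.

Lemma open_near U : (forall x, U x -> near op x U) -> op U.
Proof.
  intros H.
  replace U with (fun x => exists O, (op O /\ forall z, O z -> U z) /\ O x).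
  - apply Htop. tauto.
  - apply functional_extensionality; intros x. apply propositional_extensionality.
    split.
    + intros (O & (_ & HO) & Ox). auto.
    + intros Ux. destruct (H x Ux) as (O & HO & Ox & HU). exists O; auto.
Qed.

Lemma near_list {J : Type} (L : list J) x (P : J -> X -> Prop) :
  (forall j, In j L -> near op x (P j)) ->
  near op x (fun z => forall j, In j L -> P j z).
Proof.
  induction L as [|a L IH]; intros H.
  - eapply near_mono; [apply near_true|]. simpl; tauto.
  - eapply near_mono.
    + apply near_and; [apply (H a); simpl; auto | apply IH; simpl in H; auto].
    + simpl. intros z [Ha HL] j [<-|Hj]; auto.
Qed.

Lemma far_sym A E : far op A E -> far op E A.
Proof. intros H x. destruct (H x); auto. Qed.

Lemma far_mono A E A' E' :
  far op A E -> (forall z, A' z -> A z) -> (forall z, E' z -> E z) -> far op A' E'.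
Proof.
  intros H HA HE x.
  destruct (H x) as [N|N]; [left|right]; apply (near_mono _ _ _ N); firstorder.
Qed.

Lemma separated_sym A E : separated op A E -> separated op E A.
Proof.
  intros (M & HA & HE). exists (fun z => ~ M z). split; apply far_sym; auto.
  apply (far_mono _ _ _ _ HE); auto. intros z; apply NNPP.
Qed.

Lemma separated_mono A E A' E' :
  separated op A E -> (forall z, A' z -> A z) -> (forall z, E' z -> E z) ->
  separated op A' E'.
Proof.
  intros (M & HA & HE) HA' HE'. exists M. split.
  - apply (far_mono _ _ _ _ HA); auto.
  - apply (far_mono _ _ _ _ HE); auto.
Qed.

(** The closure of a locally finite union is the union of the closures: near [x] only the finitely
    many members listed in [L] matter. *)
Lemma far_union {J : Type} (P : J -> X -> Prop) (Q : J -> Prop) (E : X -> Prop) :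
  locally_finite op P -> (forall j, Q j -> far op (P j) E) ->
  far op (fun x => exists j, Q j /\ P j x) E.
Proof.
  intros Hlf HQ x.
  destruct (classic (near op x (fun z => ~ E z))) as [N|N]; [auto|left].
  destruct (Hlf x) as (W & HW & Wx & L & HL).
  assert (HN : near op x (fun z => forall j, In j L -> Q j -> ~ P j z)).
  { apply near_list. intros j _. destruct (classic (Q j)) as [q|q].
    - destruct (HQ j q x) as [N'|N']; [|tauto]. apply (near_mono _ _ _ N'); auto.
    - eapply near_mono; [apply near_true|]. tauto. }
  apply (near_mono _ _ _ (near_and _ _ _ HN (near_open _ _ HW Wx))).
  intros z [H Wz] (j & q & Pz). apply (H j); auto. apply HL; eauto.
Qed.

(** * Normality of paracompact Hausdorff spaces and shrinking of countable covers *)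

Section Paracompact.
Context (Hpc : paracompact op).

(** For a hereditary class [C], the open members of [C] form a cover, and any refinement of it again
    consists of members of [C]. *)
Lemma paracompact_refine (C : (X -> Prop) -> Prop) :
  (forall U V : X -> Prop, C U -> (forall z, V z -> U z) -> C V) ->
  (forall x, exists U, near op x U /\ C U) ->
  exists (J : Type) (P : J -> X -> Prop),
    open_cover op P /\ locally_finite op P /\ forall j, C (P j).
Proof.
  intros Cmono Ccov.
  destruct (proj2 Hpc {U | op U /\ C U} (fun i => proj1_sig i)) as (J & P & Pc & Pr & Plf).
  - split.
    + intros [U [HU ?]]; exact HU.
    + intros x. destruct (Ccov x) as (U & (O & HO & Ox & HOU) & CU).
      assert (CO : op O /\ C O) by (split; [|apply (Cmono U)]; auto).
      exists (exist _ O CO). exact Ox.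
  - exists J, P. repeat split; try apply Pc; auto.
    intros j. destruct (Pr j) as ([U [HU CU]] & HPU). apply (Cmono U); auto.
Qed.

(** One argument serves for both regularity and normality. In a locally finite cover whose members
    each miss [A] or have closure disjoint from that of [E], the members of the second kind unite to
    [M]. *)
Lemma separated_pointwise A E :
  (forall x, near op x (fun z => ~ A z) \/ separated op (eq x) E) -> separated op A E.
Proof.
  intros H.
  destruct (paracompact_refine (fun U => (forall z, U z -> ~ A z) \/ far op U E))
    as (J & P & [Po Pc] & Plf & PC).
  - intros U V [HU|HU] HVU; [left|right]; auto. apply (far_mono _ _ _ _ HU); auto.
  - intros x. destruct (H x) as [N|(M & HM & HE)].
    + exists (fun z => ~ A z). auto.
    + exists M. split; auto. destruct (HM x) as [N|N].
      * destruct (near_self _ _ N eq_refl).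
      * apply (near_mono _ _ _ N). intros z; apply NNPP.
  - exists (fun x => exists j, far op (P j) E /\ P j x). split.
    + intros x. destruct (Pc x) as [j Px]. destruct (PC j) as [PA|PE]; [left|right].
      * apply (near_mono _ _ _ (near_open _ _ (Po j) Px)); auto.
      * apply (near_mono _ _ _ (near_open _ _ (Po j) Px)). eauto.
    + apply (far_union P (fun j => far op (P j) E)); auto.
Qed.

Lemma near_neq x y : x <> y -> near op x (fun z => y <> z).
Proof.
  intros Hxy. destruct (proj1 Hpc x y Hxy) as (U & V & HU & HV & Ux & Vy & D).
  exists U. repeat split; auto. intros z Uz ->. apply (D z); auto.
Qed.

Lemma separated_points x y : x <> y -> separated op (eq x) (eq y).
Proof.
  intros Hxy. destruct (proj1 Hpc x y Hxy) as (U & V & HU & HV & Ux & Vy & D).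
  exists U. split; intros z.
  - destruct (classic (z = x)) as [->|Hz]; [right|left; apply near_neq; auto].
    apply (near_mono _ _ _ (near_open _ _ HU Ux)). tauto.
  - destruct (classic (z = y)) as [->|Hz]; [left|right; apply near_neq; auto].
    apply (near_mono _ _ _ (near_open _ _ HV Vy)). firstorder.
Qed.

(** The pointwise criterion runs over the points of its left set, so the complement of [B] is moved
    there by symmetry. *)
Lemma paracompact_regular x B :
  near op x B -> separated op (eq x) (fun z => ~ B z).
Proof.
  intros N. apply separated_sym, separated_pointwise. intros y.
  destruct (classic (y = x)) as [->|Hyx].
  - left. apply (near_mono _ _ _ N); auto.
  - right. apply separated_points; auto.
Qed.

Lemma paracompact_normal A E : far op A E -> separated op A E.
Proof.
  intros H. apply separated_pointwise. intros x. destruct (H x) as [N|N]; auto.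
  right. apply (separated_mono _ _ _ _ (paracompact_regular _ _ N)); auto.
Qed.

(** A stage needs, inside the union of its disjoint family, a set with room around it on which a
    Urysohn function can be 1. [G n] unites the members of a locally finite refinement whose
    closures lie in the interior of [W n]. *)
Lemma cover_shrinking (W : nat -> X -> Prop) :
  (forall x, exists n, near op x (W n)) ->
  exists G : nat -> X -> Prop,
    (forall x, exists n, near op x (G n)) /\
    forall n, far op (G n) (fun z => ~ W n z).
Proof.
  intros HW.
  destruct (paracompact_refine (fun U => exists n, far op U (fun z => ~ W n z)))
    as (J & P & [Po Pc] & Plf & PC).
  - intros U V [n HU] HVU. exists n. apply (far_mono _ _ _ _ HU); auto.
  - intros x. destruct (HW x) as [n N].
    destruct (paracompact_regular _ _ N) as (M & HM & HMW).
    exists M. split; eauto. destruct (HM x) as [N'|N'].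
    + destruct (near_self _ _ N' eq_refl).
    + apply (near_mono _ _ _ N'). intros z; apply NNPP.
  - exists (fun n x => exists j, far op (P j) (fun z => ~ W n z) /\ P j x). split.
    + intros x. destruct (Pc x) as [j Px]. destruct (PC j) as [n Hn]. exists n.
      apply (near_mono _ _ _ (near_open _ _ (Po j) Px)). eauto.
    + intros n. apply (far_union P (fun j => far op (P j) (fun z => ~ W n z))); auto.
Qed.

End Paracompact.
End Topology.

(** * Urysohn functions by binary digits *)

Section Urysohn.
Context {X : Type} (op : (X -> Prop) -> Prop) (Htop : is_topology op) (Hpc : paracompact op).

(** Choosing the set as a function of [A] and [E] alone makes all points and all depths of the
    recursion below use the same intermediate sets. *)
Definition between (A E : X -> Prop) : X -> Prop :=
  epsilon (inhabits (fun _ => True)) (fun M => far op A (fun z => ~ M z) /\ far op M E).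

Lemma between_spec A E : far op A E ->
  far op A (fun z => ~ between A E z) /\ far op (between A E) E.
Proof.
  intros H. unfold between. apply epsilon_spec. apply paracompact_normal; auto.
Qed.

(* [dyadic_step n A E x] holds the first [n] binary digits of the value at [x] of a Urysohn function
   for [A] and [E]; the first digit says whether [x] lies in the set between [A] and [E]. *)
Fixpoint dyadic_step (n : nat) (A E : X -> Prop) (x : X) : R :=
  match n with
  | O => if excluded_middle_informative (A x) then 1 else 0
  | S n =>
    let M := between A E in
    if excluded_middle_informative (M x)
    then 1 / 2 + dyadic_step n A (fun z => ~ M z) x / 2
    else dyadic_step n M E x / 2
  end.

Lemma dyadic_step_bounds n A E x : 0 <= dyadic_step n A E x <= 1.
Proof.
  revert A E; induction n as [|n IH]; intros A E; simpl;
    destruct (excluded_middle_informative _); try lra.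
  - specialize (IH A (fun z => ~ between A E z)). lra.
  - specialize (IH (between A E) E). lra.
Qed.

Lemma dyadic_step_growing A E x :
  far op A E -> Un_growing (fun n => dyadic_step n A E x).
Proof.
  intros H n. revert A E H; induction n as [|n IH]; intros A E H;
    destruct (between_spec A E H) as [HA HE].
  (* Depth 0 gives 1 exactly on [A]; such a point lies in the set between, so depth 1 gives 1
     again. *)
  - pose proof (dyadic_step_bounds 1 A E x). cbn [dyadic_step] in *.
    destruct (excluded_middle_informative (A x)) as [a|a]; [|lra].
    destruct (excluded_middle_informative _) as [m|m]; [lra|].
    destruct (HA x) as [N|N]; apply near_self in N; tauto.
  - cbn [dyadic_step] in *. destruct (excluded_middle_informative (between A E x)).
    + specialize (IH _ _ HA). lra.
    + specialize (IH _ _ HE). lra.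
Qed.

Definition urysohn_fun (A E : X -> Prop) (x : X) : R :=
  epsilon (inhabits 0) (Un_cv (fun n => dyadic_step n A E x)).

Lemma urysohn_fun_cv A E x : far op A E ->
  Un_cv (fun n => dyadic_step n A E x) (urysohn_fun A E x).
Proof.
  intros H. unfold urysohn_fun. apply epsilon_spec.
  destruct (growing_cv _ (dyadic_step_growing A E x H)) as [l Hl]; eauto.
  exists 1. intros y [n ->]. apply dyadic_step_bounds.
Qed.

Lemma Un_cv_const (c : R) : Un_cv (fun _ => c) c.
Proof.
  intros e He. exists O. intros n _. unfold Rdist. rewrite Rminus_diag, Rabs_R0. lra.
Qed.

Lemma urysohn_fun_bounds A E x : far op A E -> 0 <= urysohn_fun A E x <= 1.
Proof.
  intros H. split.
  - apply (@Rle_cv_lim (fun _ => 0) (fun n => dyadic_step n A E x));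
      [|apply Un_cv_const|apply urysohn_fun_cv; auto].
    intros n. apply dyadic_step_bounds.
  - apply (@Rle_cv_lim (fun n => dyadic_step n A E x) (fun _ => 1));
      [|apply urysohn_fun_cv; auto|apply Un_cv_const].
    intros n. apply dyadic_step_bounds.
Qed.

(** The recursion passes to the limit. The estimates below unfold this self-similarity, each
    unfolding halving the error. *)
Lemma urysohn_fun_eq A E x : far op A E ->
  urysohn_fun A E x =
    let M := between A E in
    if excluded_middle_informative (M x)
    then 1 / 2 + urysohn_fun A (fun z => ~ M z) x / 2
    else urysohn_fun M E x / 2.
Proof.
  intros H. destruct (between_spec A E H) as [HA HE].
  assert (Hs : Un_cv (fun n => dyadic_step (S n) A E x) (urysohn_fun A E x)).
  { intros e He. destruct (urysohn_fun_cv A E x H e He) as [N HN].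
    exists N. intros n Hn. apply HN. lia. }
  apply (UL_sequence _ _ _ Hs). cbn [dyadic_step].
  destruct (excluded_middle_informative _); cbv zeta.
  - apply (CV_plus (fun _ => 1 / 2) (fun n => dyadic_step n A (fun z => ~ between A E z) x / 2));
      [apply Un_cv_const|].
    apply (CV_mult (fun n => dyadic_step n A (fun z => ~ between A E z) x) (fun _ => / 2));
      [apply urysohn_fun_cv; auto|apply Un_cv_const].
  - apply (CV_mult (fun n => dyadic_step n (between A E) E x) (fun _ => / 2));
      [apply urysohn_fun_cv; auto|apply Un_cv_const].
Qed.

Lemma eq0_of_le_pow2 (r : R) : 0 <= r -> (forall n, r <= (1 / 2) ^ n) -> r = 0.
Proof.
  intros H0 H. apply Rle_antisym; auto. apply le_epsilon. intros e He.
  destruct (pow_lt_1_zero (1 / 2) ltac:(rewrite Rabs_right; lra) e He) as [N HN].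
  specialize (HN N (le_n _)). specialize (H N). apply Rabs_def2 in HN. lra.
Qed.

(** A point of the closure of [A] lies in every set between, so each unfolding halves the distance
    of the value from 1. Closure points are included because continuity at boundary points needs
    them. *)
Lemma urysohn_fun_1 A E x :
  far op A E -> ~ near op x (fun z => ~ A z) -> urysohn_fun A E x = 1.
Proof.
  intros H Hx. enough (1 - urysohn_fun A E x = 0) by lra.
  apply eq0_of_le_pow2; [pose proof (urysohn_fun_bounds A E x H); lra|].
  intros n. revert E H. induction n as [|n IH]; intros E H.
  - pose proof (urysohn_fun_bounds A E x H). simpl; lra.
  - rewrite urysohn_fun_eq by auto. cbv zeta. destruct (between_spec A E H) as [HA HE].
    destruct (excluded_middle_informative _) as [m|m].
    + specialize (IH _ HA). simpl. lra.
    + destruct (HA x) as [N|N]; [tauto|]. apply near_self in N. tauto.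
Qed.

Lemma urysohn_fun_0 A E x :
  far op A E -> ~ near op x (fun z => ~ E z) -> urysohn_fun A E x = 0.
Proof.
  intros H Hx. apply eq0_of_le_pow2; [apply urysohn_fun_bounds; auto|].
  intros n. revert A H. induction n as [|n IH]; intros A H.
  - pose proof (urysohn_fun_bounds A E x H). simpl; lra.
  - rewrite urysohn_fun_eq by auto. cbv zeta. destruct (between_spec A E H) as [HA HE].
    destruct (excluded_middle_informative _) as [m|m].
    + destruct (HE x) as [N|N]; [|tauto]. apply near_self in N. tauto.
    + specialize (IH _ HE). simpl. lra.
Qed.

(** In the interior of [M] or of its complement a single branch of the recursion holds nearby and
    halves the oscillation. A boundary point lies in the closures of both, so both branches give 1/2
    there and match. *)
Lemma urysohn_fun_oscillation n A E x : far op A E ->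
  near op x (fun z => - (1 / 2) ^ n <= urysohn_fun A E x - urysohn_fun A E z <= (1 / 2) ^ n).
Proof.
  revert A E; induction n as [|n IH]; intros A E H.
  - apply (near_mono _ _ _ _ (near_true op Htop x)). intros z _. simpl.
    pose proof (urysohn_fun_bounds A E x H). pose proof (urysohn_fun_bounds A E z H).
    lra.
  - destruct (between_spec A E H) as [HA HE].
    set (M := between A E) in *. set (NM := fun z => ~ M z) in *.
    assert (Heq : forall z, urysohn_fun A E z =
      if excluded_middle_informative (M z)
      then 1 / 2 + urysohn_fun A NM z / 2 else urysohn_fun M E z / 2).
    { intros z. apply urysohn_fun_eq; auto. }
    pose proof (near_and _ Htop _ _ _ (IH _ _ HA) (IH _ _ HE)) as N.
    destruct (classic (near op x M)) as [NM1|NM1];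
      [|destruct (classic (near op x NM)) as [NM2|NM2]].
    + apply (near_mono _ _ _ _ (near_and _ Htop _ _ _ N NM1)).
      intros z [[Hz _] Mz]. apply near_self in NM1. rewrite !Heq.
      do 2 (destruct (excluded_middle_informative _); [|tauto]).
      simpl. lra.
    + apply (near_mono _ _ _ _ (near_and _ Htop _ _ _ N NM2)).
      intros z [[_ Hz] Mz]. apply near_self in NM2. rewrite !Heq.
      do 2 (destruct (excluded_middle_informative _); [exfalso; unfold NM in *; tauto|]).
      simpl. lra.
    + assert (U0 : urysohn_fun A NM x = 0).
      { apply urysohn_fun_0; auto. intros N'. apply NM1.
        apply (near_mono _ _ _ _ N'). intros z; apply NNPP. }
      assert (U1 : urysohn_fun M E x = 1) by (apply urysohn_fun_1; auto).
      apply (near_mono _ _ _ _ N). intros z [Hz Hz']. rewrite !Heq, U0, U1 in *.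
      simpl.
      pose proof (urysohn_fun_bounds A NM z HA). pose proof (urysohn_fun_bounds M E z HE).
      do 2 destruct (excluded_middle_informative _); lra.
Qed.

Lemma urysohn A E : far op A E ->
  exists s : X -> R,
    (forall x, 0 <= s x <= 1) /\ (forall x, A x -> s x = 1) /\ (forall x, E x -> s x = 0) /\
    forall x e, 0 < e -> near op x (fun z => Rabs (s x - s z) < e).
Proof.
  intros H. exists (urysohn_fun A E). repeat split; try (apply urysohn_fun_bounds; auto).
  - intros x a. apply urysohn_fun_1; auto. intros N. apply near_self in N. auto.
  - intros x a. apply urysohn_fun_0; auto. intros N. apply near_self in N. auto.
  - intros x e He.
    destruct (pow_lt_1_zero (1 / 2) ltac:(rewrite Rabs_right; lra) e He) as [n Hn].
    specialize (Hn n (le_n _)). apply Rabs_def2 in Hn.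
    apply (near_mono _ _ _ _ (urysohn_fun_oscillation n A E x H)). intros z Hz.
    apply Rabs_def1; lra.
Qed.

(* The clamped double [max 0 (2 s - 1)] of a Urysohn function vanishes near [E], not only on it. *)
Lemma urysohn_strong A E : far op A E ->
  exists s : X -> R,
    (forall x, 0 <= s x <= 1) /\ (forall x, A x -> s x = 1) /\
    (forall x, E x -> near op x (fun z => s z = 0)) /\
    forall x e, 0 < e -> near op x (fun z => Rabs (s x - s z) < e).
Proof.
  intros H. destruct (urysohn A E H) as (s & Hb & HA & HE & Hc).
  exists (fun x => Rmax 0 (2 * s x - 1)). repeat split.
  - apply Rmax_l.
  - apply Rmax_lub; [lra|]. specialize (Hb x). lra.
  - intros x a. rewrite HA by auto. rewrite Rmax_right; lra.
  - intros x a. apply (near_mono _ _ _ _ (Hc x (1 / 2) ltac:(lra))). intros z Hz.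
    rewrite HE in Hz by auto. apply Rabs_def2 in Hz. apply Rmax_left. lra.
  - intros x e He. apply (near_mono _ _ _ _ (Hc x (e / 2) ltac:(lra))). intros z Hz.
    apply Rabs_def2 in Hz. apply Rabs_def1; unfold Rmax;
      do 2 destruct (Rle_dec _ _); lra.
Qed.

End Urysohn.

(** * Composites that become constant, and their limit *)

Section Selection.
Context {X Y : Type} (op : (X -> Prop) -> Prop) (rho : Y -> Y -> R).
Context (Htop : is_topology op) (Hpc : paracompact op) (Hrho : is_metric rho).

Definition jointly_continuous_on (D : X -> Y -> Prop) (T : X -> Y -> Y) : Prop :=
  forall x y, D x y -> forall e, 0 < e -> exists d, 0 < d /\
    near op x (fun z => forall y', D z y' -> rho y y' < d -> rho (T x y) (T z y') < e).

(** New maps enter on the inside, so a composite that is constant in [y] is left unchanged by all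
    later maps. *)
Fixpoint iterated (T : nat -> X -> Y -> Y) (n : nat) (x : X) (y : Y) : Y :=
  match n with
  | O => y
  | S n => iterated T n x (T n x y)
  end.

Section Limit.
Context (S : nat -> X -> Y -> Prop) (T : nat -> X -> Y -> Y).
Context (S_nonempty : forall n x, exists y, S n x y).
Context (T_range : forall n x y, S (n + 1)%nat x y -> S n x (T n x y)).
Context (T_cont : forall n, jointly_continuous_on (S (n + 1)%nat) (T n)).
Context (T_const : forall x, exists n c,
  near op x (fun z => forall y, S (n + 1)%nat z y -> T n z y = c)).

Lemma iterated_range n x y : S n x y -> S 0%nat x (iterated T n x y).
Proof.
  revert y; induction n as [|n IH]; intros y Hy; simpl; auto.
  apply IH, T_range. rewrite Nat.add_1_r. exact Hy.
Qed.

Lemma iterated_jointly_continuous n : jointly_continuous_on (S n) (iterated T n).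
Proof.
  induction n as [|n IH]; intros x y Hy e He; simpl.
  - exists e. split; auto. apply (near_mono _ _ _ _ (near_true op Htop x)). auto.
  - rewrite <- Nat.add_1_r in *.
    destruct (IH x (T n x y) (T_range _ _ _ Hy) e He) as (d & Hd & N).
    destruct (T_cont n x y Hy d Hd) as (d' & Hd' & N').
    exists d'. split; auto. apply (near_mono _ _ _ _ (near_and _ Htop _ _ _ N N')).
    intros z [Hz Hz'] y' Hy' Hyy'. apply Hz; auto.
Qed.

Definition eventual_value (x : X) (v : Y) : Prop :=
  exists n, forall m, (n <= m)%nat -> forall y, S m x y -> iterated T m x y = v.

Lemma eventual_value_unique x v w : eventual_value x v -> eventual_value x w -> v = w.
Proof.
  intros [n Hn] [m Hm]. destruct (S_nonempty (n + m) x) as [y Hy].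
  rewrite <- (Hn (n + m)%nat ltac:(lia) y Hy). apply Hm; auto; lia.
Qed.

(** Every composite of more than [n] maps passes through [T n], which collapses the fibre to [c]. *)
Lemma eventual_value_const n x c :
  (forall y, S (n + 1)%nat x y -> T n x y = c) -> eventual_value x (iterated T n x c).
Proof.
  intros Hc. exists (n + 1)%nat. intros m Hm.
  replace m with (m - (n + 1) + (n + 1))%nat by lia.
  induction (m - (n + 1))%nat as [|k IH]; intros y Hy.
  - rewrite Nat.add_0_l, Nat.add_1_r in *. simpl. rewrite Hc; auto.
  - simpl. apply IH, T_range. rewrite Nat.add_1_r. exact Hy.
Qed.

Lemma limit_selection :
  exists f : X -> Y, continuous op (metric_open rho) f /\ forall x, S 0%nat x (f x).
Proof.
  assert (Hex : forall x, exists v, eventual_value x v /\ S 0%nat x v).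
  { intros x. destruct (T_const x) as (n & c & N). apply near_self in N.
    exists (iterated T n x c). split; [apply eventual_value_const; auto|].
    apply iterated_range. destruct (S_nonempty (n + 1) x) as [y Hy].
    rewrite <- (N y Hy). auto. }
  exists (fun x => proj1_sig (constructive_indefinite_description _ (Hex x))). split.
  - intros V HV. apply open_near; auto. intros x.
    destruct (constructive_indefinite_description _ (Hex x)) as (v & Hv & ?); simpl.
    intros Vv. destruct (HV v Vv) as (r & Hr & HrV).
    destruct (T_const x) as (n & c & N).
    assert (Hc : S n x c).
    { destruct (S_nonempty (n + 1) x) as [y Hy].
      rewrite <- (near_self _ _ _ N y Hy). auto. }
    destruct (iterated_jointly_continuous n x c Hc r Hr) as (d & Hd & N').
    apply (near_mono _ _ _ _ (near_and _ Htop _ _ _ N N')). intros z [Hz Hz'].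
    destruct (constructive_indefinite_description _ (Hex z)) as (w & Hw & ?); simpl.
    apply HrV.
    (* The same [n] and [c] serve at [x] and at all nearby [z], so continuity reduces to that of the
       composite of the first [n] maps at the fixed argument [c]. *)
    rewrite (eventual_value_unique _ _ _ Hv (eventual_value_const n x c (near_self _ _ _ N))).
    rewrite (eventual_value_unique _ _ _ Hw (eventual_value_const n z c Hz)).
    apply Hz'.
    + destruct (S_nonempty (n + 1) z) as [y Hy]. rewrite <- (Hz y Hy). auto.
    + replace (rho c c) with 0; auto. symmetry. apply Hrho. reflexivity.
  - intros x. destruct (constructive_indefinite_description _ (Hex x)) as (v & ? & ?). auto.
Qed.

End Limit.

(* A layer carries, over an open cover, contractions [hom j] of sets [dom j] to points [ctr j] that
   take the fibres of [src] lying over the member [cov j] into the fibres of [dst]. *)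
Record layer := {
  dst : X -> Y -> Prop;
  src : X -> Y -> Prop;
  idx : Type;
  cov : idx -> X -> Prop;
  dom : idx -> Y -> Prop;
  hom : idx -> Y -> R -> Y;
  ctr : idx -> Y;
  cov_open_cover : open_cover op cov;
  hom_cont : forall j, continuous_on_cyl rho (dom j) (hom j);
  hom_0 : forall j y, dom j y -> hom j y 0 = y;
  hom_1 : forall j y, dom j y -> hom j y 1 = ctr j;
  src_dom : forall j x y, cov j x -> src x y -> dom j y;
  hom_dst : forall j x y t, cov j x -> src x y -> 0 <= t <= 1 -> dst x (hom j y t)
}.

(** Time 0 of a homotopy is the identity. *)
Lemma src_dst (l : layer) x y : src l x y -> dst l x y.
Proof.
  intros Hy. destruct (proj2 (cov_open_cover l) x) as [j Hj].
  rewrite <- (hom_0 l j y) by (eapply src_dom; eauto).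
  eapply hom_dst; eauto. lra.
Qed.

(** * One stage: contracting fibres along a disjoint family *)

Section Stage.
Context (l : layer) (J : Type) (V : J -> X -> Prop) (G : X -> Prop).
Context (V_open : forall v, op (V v)) (V_disj : pairwise_disjoint V).
Context (V_refines : refines V (cov l)).
Context (HG : far op G (fun x => ~ exists v, V v x)).

(** Over [V v] the homotopy runs up to time [s x]. Since [s] vanishes around each point outside the
    union of the family, the map is the identity on the fibres near such a point, which gives
    continuity there; on [G] time 1 is reached. *)
Lemma stage_map : exists T : X -> Y -> Y,
  jointly_continuous_on (src l) T /\
  (forall x y, src l x y -> dst l x (T x y)) /\
  (forall x, near op x G -> exists c, near op x (fun z => forall y, src l z y -> T z y = c)).
Proof.
  destruct (urysohn_strong op Htop Hpc _ _ HG) as (s & Hb & H1 & H0 & Hs).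
  destruct (choice _ V_refines) as [r Hr].
  (* The family being disjoint, the member picked by the description is the only one containing
     [x]. *)
  pose (T := fun x y => match excluded_middle_informative (exists v, V v x) with
    | left h => hom l (r (proj1_sig (constructive_indefinite_description _ h))) y (s x)
    | right _ => y end).
  assert (Tin : forall v x y, V v x -> T x y = hom l (r v) y (s x)).
  { intros v x y Hv. unfold T. destruct (excluded_middle_informative _) as [h|h].
    - destruct (constructive_indefinite_description _ h) as [w Hw]; simpl.
      destruct (classic (v = w)) as [<-|Hvw]; auto. destruct (V_disj v w Hvw x); auto.
    - destruct h; eauto. }
  assert (Tout : forall x y, src l x y -> s x = 0 -> T x y = y).
  { intros x y Hy Hx. unfold T. destruct (excluded_middle_informative _) as [h|h]; auto.
    destruct (constructive_indefinite_description _ h) as [w Hw]; simpl.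
    rewrite Hx. apply hom_0. eapply src_dom; eauto. }
  exists T. split; [|split].
  - intros x y Hy e He.
    destruct (classic (exists v, V v x)) as [[v Hv]|Hx].
    + destruct (hom_cont l (r v) y (s x)) with (e := e) as (d & Hd & Hcont); auto.
      { eapply src_dom; eauto. }
      exists d. split; auto.
      apply (near_mono _ _ _ _ (near_and _ Htop _ _ _ (near_open _ _ _ (V_open v) Hv)
                                  (Hs x d Hd))).
      intros z [Hz Hsz] y' Hy' Hyy'. rewrite !(Tin v) by auto. apply Hcont; auto.
      eapply src_dom; eauto.
    + exists e. split; auto. apply (near_mono _ _ _ _ (H0 x Hx)). intros z Hz y' Hy' Hyy'.
      rewrite !Tout; auto. apply (near_self _ _ _ (H0 x Hx)).
  - intros x y Hy. destruct (classic (exists v, V v x)) as [[v Hv]|Hx].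
    + rewrite (Tin v) by auto. eapply hom_dst; eauto.
    + rewrite Tout; [apply src_dst| |apply (near_self _ _ _ (H0 x Hx))]; auto.
  - intros x NG. destruct (HG x) as [N|N].
    { destruct (near_self _ _ _ N (near_self _ _ _ NG)). }
    apply near_self in N. apply NNPP in N. destruct N as [v Hv]. exists (ctr l (r v)).
    apply (near_mono _ _ _ _ (near_and _ Htop _ _ _ (near_open _ _ _ (V_open v) Hv) NG)).
    intros z [Hz Gz] y Hy. rewrite (Tin v), H1 by auto. apply hom_1. eapply src_dom; eauto.
Qed.

End Stage.

(** * Layers from the CE property, and selections of thick relations *)

Section Layers.
Context (phi : X -> Y -> Prop) (Hcont : rho_continuous op rho phi).
Context (HUV : forall x, uniformly_UV_infty rho (phi x)).

Definition thick (S : X -> Y -> Prop) : Prop :=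
  forall p, exists e, 0 < e /\
    near op p (fun x => forall y, O_nbhd rho e (phi x) y -> S x y).

Lemma O_nbhd_trans a b (A B : Y -> Prop) y :
  O_nbhd rho a A y -> subset A (O_nbhd rho b B) -> O_nbhd rho (a + b) B y.
Proof.
  intros (q & Aq & Hq) AB. destruct (AB q Aq) as (q' & Bq' & Hq'). exists q'. split; auto.
  destruct Hrho as (_ & _ & _ & tri). specialize (tri y q q'). lra.
Qed.

Lemma O_nbhd_le a b (A : Y -> Prop) y : O_nbhd rho a A y -> a <= b -> O_nbhd rho b A y.
Proof. intros (q & Aq & Hq) Hab. exists q. split; auto. lra. Qed.

Lemma common_radius {J : Type} (L : list J) (d : J -> R) :
  (forall j, 0 < d j) -> exists m, 0 < m /\ forall j, In j L -> m <= d j.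
Proof.
  intros Hd. induction L as [|a L (m & Hm & HL)].
  - exists 1. split; [lra|]. simpl; tauto.
  - exists (Rmin m (d a)). split; [apply Rmin_pos; auto|].
    intros j [<-|Hj]; [apply Rmin_r|]. eapply Rle_trans; [apply Rmin_l|auto].
Qed.

Lemma local_contraction S p : thick S ->
  exists (d : R) (H : Y -> R -> Y) (c : Y), 0 < d /\
    continuous_on_cyl rho (O_nbhd rho (2 * d) (phi p)) H /\
    (forall y, O_nbhd rho (2 * d) (phi p) y -> H y 0 = y) /\
    (forall y, O_nbhd rho (2 * d) (phi p) y -> H y 1 = c) /\
    near op p (fun x => forall y, O_nbhd rho d (phi x) y ->
      O_nbhd rho (2 * d) (phi p) y /\ forall t, 0 <= t <= 1 -> S x (H y t)).
Proof.
  intros HS. destruct (HS p) as (e & He & N).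
  (* Contracting within [e / 2] of [phi p] leaves room for passing from [phi p] to [phi x]: with
     [d <= e / 2], the sum [e / 2 + d / 2] is below [e]. *)
  destruct (HUV p (e / 2) ltac:(lra)) as (d & Hd & Hde & H & c & Hc & HB & Hz & Ho).
  (* Where [phi x] is within [d / 2] of [phi p], the neighbourhood of [phi x] of radius [d / 2] lies
     in the domain of the contraction, of radius [d] around [phi p]. *)
  exists (d / 2), H, c. replace (2 * (d / 2)) with d by lra.
  repeat split; auto; [lra|].
  destruct (Hcont (d / 2) ltac:(lra) p) as (V1 & OV1 & V1p & HV1).
  apply (near_mono _ _ _ _ (near_and _ Htop _ _ _ N (near_open _ _ _ OV1 V1p))).
  intros x [HSx Vx] y Hy. destruct (HV1 x Vx) as [Hpx Hxp].
  assert (Hyp : O_nbhd rho d (phi p) y).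
  { apply (O_nbhd_le (d / 2 + d / 2)); [eapply O_nbhd_trans; eauto|lra]. }
  split; auto. intros t Ht. apply HSx.
  apply (O_nbhd_le (e / 2 + d / 2)); [|lra]. eapply O_nbhd_trans; [apply HB|]; auto.
Qed.

Lemma layer_exists S : thick S -> exists l : layer, dst l = S /\ thick (src l).
Proof.
  intros HS.
  destruct (choice _ (fun p => local_contraction S p HS)) as [d Hd].
  destruct (choice _ Hd) as [H HH]. destruct (choice _ HH) as [c Hc].
  pose (good := fun p x => forall y, O_nbhd rho (d p) (phi x) y ->
    O_nbhd rho (2 * d p) (phi p) y /\ forall t, 0 <= t <= 1 -> S x (H p y t)).
  destruct (paracompact_refine op Hpc (fun U => exists p, forall x, U x -> good p x))
    as (J & P & Pc & Plf & PC).
  { intros U V [p HU] HVU. eauto. }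
  { intros p. exists (good p). split; eauto. apply Hc. }
  destruct (choice _ PC) as [r Hr].
  (* A point may lie in several members of the cover. The fibre of [src] is the intersection of the
     neighbourhoods they allow, so it lies in the domain of each. *)
  unshelve eexists {| dst := S; idx := J; cov := P;
    src := fun x y => forall j, P j x -> O_nbhd rho (d (r j)) (phi x) y;
    dom := fun j => O_nbhd rho (2 * d (r j)) (phi (r j));
    hom := fun j => H (r j); ctr := fun j => c (r j) |}; auto; simpl.
  - intros j. apply Hc.
  - intros j. apply Hc.
  - intros j. apply Hc.
  - intros j x y Hx Hy. apply (Hr j x Hx). auto.
  - intros j x y t Hx Hy Ht. apply (Hr j x Hx); auto.
  (* Near [p] only finitely many members count, so the least of their radii serves. *)
  - split; auto. intros p. destruct (Plf p) as (W & HW & Wp & L & HL).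
    destruct (common_radius L (fun j => d (r j))) as (m & Hm & HmL).
    { intros j. apply Hc. }
    exists m. split; auto.
    apply (near_mono _ _ _ _ (near_open _ _ _ HW Wp)). intros x Wx y Hy j Hj.
    apply (O_nbhd_le m); auto. apply HmL, HL. eauto.
Qed.

Lemma layer_sequence S : thick S ->
  exists l : nat -> layer, dst (l O) = S /\
    forall n, dst (l (n + 1)%nat) = src (l n) /\ thick (src (l n)).
Proof.
  intros HS.
  destruct (layer_exists S HS) as (l0 & H0 & H0').
  (* Thickness as a premise makes the relation total, so plain choice gives a successor function;
     thickness along the sequence then follows by induction. *)
  destruct (choice (fun (l l' : layer) => thick (src l) -> dst l' = src l /\ thick (src l')))
    as [next Hnext].
  { intros l. destruct (classic (thick (src l))) as [h|h].
    - destruct (layer_exists _ h) as [l' Hl']. eauto.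
    - exists l. tauto. }
  exists (fun n => Nat.iter n next l0). split; auto.
  assert (Ht : forall n, thick (src (Nat.iter n next l0))).
  { intros n; induction n as [|n IH]; simpl; auto. apply Hnext; auto. }
  intros n. split; auto. rewrite Nat.add_1_r. simpl. apply Hnext; auto.
Qed.

Context (HC : C_space op) (Hne : forall x, exists y, phi x y).

Lemma thick_nonempty S x : thick S -> exists y, S x y.
Proof.
  intros HS. destruct (HS x) as (e & He & N). apply near_self in N.
  destruct (Hne x) as [y Hy]. exists y. apply N. exists y. split; auto.
  replace (rho y y) with 0; auto. symmetry. apply Hrho. reflexivity.
Qed.

Lemma thick_selection S : thick S ->
  exists f : X -> Y, continuous op (metric_open rho) f /\ forall x, S x (f x).
Proof.
  intros HS. destruct (layer_sequence S HS) as (l & <- & Hl).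
  (* The layers are built without reference to the families [V n], so the C-property applies to all
     their covers at once. *)
  destruct (HC (fun n => idx (l n)) (fun n => cov (l n)))
    as (J & V & Vo & Vd & Vr & Vc); [intros n; apply cov_open_cover|].
  destruct (cover_shrinking op Htop Hpc (fun n x => exists v, V n v x)) as (G & HGc & HG).
  { intros x. destruct (Vc x) as (n & v & Hv). exists n.
    apply (near_mono _ _ _ _ (near_open _ _ _ (Vo n v) Hv)). eauto. }
  destruct (choice _ (fun n => stage_map (l n) (J n) (V n) (G n) (Vo n) (Vd n) (Vr n) (HG n)))
    as [T HT].
  assert (Hsrc : forall n, dst (l (n + 1)%nat) = src (l n)) by (intros n; apply Hl).
  (* With destinations as the sequence of relations, term 0 is the given relation and [T n] maps
     term [n + 1], the source of layer [n], into term [n]. *)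
  apply (limit_selection (fun n => dst (l n)) T).
  - intros n x. apply thick_nonempty. destruct n as [|n]; auto.
    rewrite <- Nat.add_1_r, Hsrc. apply Hl.
  - intros n x y. rewrite Hsrc. apply HT.
  - intros n. rewrite Hsrc. apply HT.
  - intros x. destruct (HGc x) as [n Hn]. exists n. rewrite Hsrc. apply HT; auto.
Qed.

End Layers.
End Selection.

Theorem theorem4p1 (X Y : Type) (op : (X -> Prop) -> Prop) (rho : Y -> Y -> R)
  (phi : X -> Y -> Prop)
  (Htop : is_topology op) (Hpc : paracompact op) (HC : C_space op)
  (Hrho : is_metric rho)
  (Hne : forall x, exists y, phi x y)
  (Hcont : rho_continuous op rho phi)
  (HUV : forall x, uniformly_UV_infty rho (phi x)) :
  forall eps : X -> R, continuous op (metric_open abs_dist) eps -> (forall x, 0 < eps x) ->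
    exists f : X -> Y, continuous op (metric_open rho) f /\
      (forall x, O_nbhd rho (eps x) (phi x) (f x)).
Proof.
  intros eps Heps Hpos. apply (thick_selection op rho Htop Hpc Hrho phi Hcont HUV HC Hne
    (fun x => O_nbhd rho (eps x) (phi x))).
  (* The radius [eps p / 2] works wherever [eps] exceeds it, which is an open set around [p]. *)
  intros p. exists (eps p / 2). specialize (Hpos p). split; [lra|].
  assert (Ho : metric_open abs_dist (fun r => eps p / 2 < r)).
  { intros r Hr. exists (r - eps p / 2). split; [lra|]. intros z Hz.
    unfold abs_dist in Hz. apply Rabs_def2 in Hz. lra. }
  apply (near_mono _ _ _ _ (near_open op _ p (Heps _ Ho) ltac:(lra))).
  intros x Hx y Hy. apply (O_nbhd_le rho (eps p / 2)); auto. lra.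
Qed.
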